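(* Any Fano manifold $X\subset\mathbb{P}^N$ is covered by linear spaces of dimension at least $S_X$, where $S_X$ is the invariant defined in the context.
   Context: A Fano manifold $X\subset\mathbb{P}^N$ is a smooth complex projective variety, embedded in a projective space, with ample anti-canonical line bundle $-K_X$. A line on $X$ is a line of $\mathbb{P}^N$ contained in $X$; a linear space in $X$ is a linear subspace of $\mathbb{P}^N$ contained in $X$. $X$ is covered by lines (resp. by linear spaces of a given dimension) if a line (resp. such a linear space) contained in $X$ passes through a general point of $X$. Families of lines. For a general point $x\in X$, let $F_1(X,x)$ be the Hilbert scheme of lines on $X$ passing through $x$. An irreducible component $H$ of $F_1(X,x)$ is called a family of lines on $X$ through $x$. Put $\mathbb{P}(T_xX^\vee):=(T_xX\setminus\{0\})/\mathbb{C}^\times\cong\mathbb{P}^{\dim X-1}$. Sending a line to its tangent direction at $x$ identifies $H$ with a smooth projective subvariety of $\mathbb{P}(T_xX^\vee)$ (a known fact), and $H$ is always regarded as so embedded. Higher order families. Write $X\models H$ if $X$ is an embedded Fano manifold covered by lines and $H$ is a family of lines on $X$ through a fixed general point. If $X\models H_1$ and $H_1$ is again a Fano manifold covered by lines in its projectivised tangent space $\mathbb{P}(T_xX^\vee)$, one considers $H_1\models H_2$, a family of lines on $H_1$ through a fixed general point of $H_1$, and so on. If there is a chain $X\models H_1\models H_2\models\cdots\models H_m$ of length $m$, then $H_m$ is called an $m$-th order family of lines. The invariant $S_X$ is the greatest $m$ such that there is an $m$-th order family of lines; $S_X=0$ if $X$ is not covered by lines. *)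

(* Defs.v *)
From HB Require Import structures.
From mathcomp Require Import all_boot all_order all_algebra.
From mathcomp Require Import boolp classical_sets reals complex mpoly.
Set Implicit Arguments.
Unset Strict Implicit.
Unset Printing Implicit Defensive.
Import GRing.Theory.
Local Open Scope ring_scope.
Local Open Scope classical_set_scope.
Local Open Scope complex_scope.

(* Classical projective geometry over R[i].  A point of P(C^k) is given by its
   nonzero representatives in 'rV_k, and a subset of P(C^k) by its punctured
   cone, a set of nonzero vectors stable under scaling.  So P^N is P(C^(N+1)). *)

Definition proj_eq (R : realType) k (v w : 'rV[R[i]]_k) :=
  exists2 c : R[i], c != 0 & w = c *: v.

Definition homogeneous (R : realType) k (f : {mpoly R[i][k]}) :=
  exists d, f \is d.-homog.

Definition evalp (R : realType) k (f : {mpoly R[i][k]}) (v : 'rV[R[i]]_k) :=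
  f.@[fun i => v 0 i].

(* The derivative of f at v in the direction w. *)
Definition diffp (R : realType) k (f : {mpoly R[i][k]}) (v w : 'rV[R[i]]_k) :=
  \sum_i evalp f^`M(i) v * w 0 i.

(* The derivative of p / q at v in the direction w. *)
Definition diff_frac (R : realType) k (p q : {mpoly R[i][k]})
    (v w : 'rV[R[i]]_k) :=
  (evalp q v * diffp p v w - evalp p v * diffp q v w) / evalp q v ^+ 2.

Definition pclosed (R : realType) k (Z : set 'rV[R[i]]_k) :=
  exists2 F : set {mpoly R[i][k]}, F `<=` @homogeneous R k &
    Z = [set v | v != 0 /\ forall f, F f -> evalp f v = 0].

Definition pirreducible (R : realType) k (Z : set 'rV[R[i]]_k) :=
  [/\ Z !=set0, pclosed Z & forall A B, pclosed A -> pclosed B ->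
      Z `<=` A `|` B -> Z `<=` A \/ Z `<=` B].

Definition pcomponent (R : realType) k (H Z : set 'rV[R[i]]_k) :=
  [/\ pirreducible H, H `<=` Z & forall H', pirreducible H' ->
      H `<=` H' -> H' `<=` Z -> H' = H].

(* P holds at a general point of X. *)
Definition generally (R : realType) k (X P : set 'rV[R[i]]_k) :=
  exists A, [/\ pclosed A, ~ (X `<=` A) & forall v, X v -> ~ A v -> P v].

Definition irr_chain (R : realType) k (X : set 'rV[R[i]]_k) n :=
  exists Z : nat -> set 'rV[R[i]]_k,
    (forall i, (i <= n)%N -> pirreducible (Z i) /\ Z i `<=` X) /\
    (forall i, (i < n)%N -> Z i `<=` Z i.+1 /\ Z i <> Z i.+1).

(* Krull dimension *)
Definition has_dim (R : realType) k (X : set 'rV[R[i]]_k) n :=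
  irr_chain X n /\ ~ irr_chain X n.+1.

(* The tangent space at v to the cone over X. *)
Definition cone_tangent (R : realType) k (X : set 'rV[R[i]]_k)
    (v w : 'rV[R[i]]_k) :=
  forall f, homogeneous f -> (forall u, X u -> evalp f u = 0) ->
    diffp f v w = 0.

(* The Zariski tangent space T_[v]X is the quotient of cone_tangent X v by the
   line spanned by v.  The rows t_1, ..., t_n of tau represent a basis of it;
   equivalently, u |-> u *m tau induces an isomorphism from C^n to T_[v]X. *)
Definition tangent_frame (R : realType) k (X : set 'rV[R[i]]_k)
    (v : 'rV[R[i]]_k) n (tau : 'M[R[i]]_(n, k)) :=
  row_free (col_mx v tau) /\
  forall w, cone_tangent X v w <-> (w <= col_mx v tau)%MS.

(* X is a smooth projective variety of dimension n. *)
Definition smooth_variety (R : realType) k (X : set 'rV[R[i]]_k) n :=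
  [/\ pirreducible X, has_dim X n & forall v, X v ->
      exists tau : 'M[R[i]]_(n, k), tangent_frame X v tau].

(* The function g of points of U is locally a quotient of two homogeneous
   polynomials of the same degree. *)
Definition regular_on (R : realType) k (U : set 'rV[R[i]]_k)
    (g : 'rV[R[i]]_k -> R[i]) :=
  forall v, U v -> exists d (p q : {mpoly R[i][k]}),
    [/\ p \is d.-homog, q \is d.-homog, evalp q v != 0 & forall w, U w ->
        evalp q w != 0 -> g w = evalp p w / evalp q w].

(* On X, phi is a morphism to P(C^r): it is locally given, up to scalars, by
   homogeneous polynomials of the same degree without common zeros. *)
Definition pmorphism (R : realType) k r (X : set 'rV[R[i]]_k)
    (phi : 'rV[R[i]]_k -> 'rV[R[i]]_r) :=
  forall v, X v -> exists d (P : 'I_r -> {mpoly R[i][k]}),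
    [/\ forall i, P i \is d.-homog, exists i, evalp (P i) v != 0 &
      forall w, X w -> (exists i, evalp (P i) w != 0) ->
        proj_eq (\row_i evalp (P i) w) (phi w)].

Definition pimage (R : realType) k r (X : set 'rV[R[i]]_k)
    (phi : 'rV[R[i]]_k -> 'rV[R[i]]_r) : set 'rV[R[i]]_r :=
  [set y | exists2 v, X v & proj_eq (phi v) y].

(* phi is an isomorphism from X to a closed subvariety of P(C^r). *)
Definition closed_embedding (R : realType) k r (X : set 'rV[R[i]]_k)
    (phi : 'rV[R[i]]_k -> 'rV[R[i]]_r) :=
  [/\ pmorphism X phi, pclosed (pimage X phi) &
    exists2 psi, pmorphism (pimage X phi) psi &
      forall v, X v -> proj_eq v (psi (phi v))].

(* Global sections of (-K_X)^m, where -K_X is the n-th exterior power of the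
   tangent bundle.  The section is written in frames:  at [v] it is
     s v tau . (t_1 /\ ... /\ t_n)^m        (m-th tensor power),
   where t_1, ..., t_n is the basis of T_[v]X given by tau.  It is algebraic
   when its contractions with the forms (dg_1 /\ ... /\ dg_n)^m are regular, for
   local regular functions g_i = p_i / q_i.  That the value at [v] does not
   depend on tau (nor on the choice of v) is enforced by g depending on neither. *)
Definition anticanonical_section (R : realType) k (X : set 'rV[R[i]]_k) n
    (m : nat) (s : 'rV[R[i]]_k -> 'M[R[i]]_(n, k) -> R[i]) :=
  forall (d : 'I_n -> nat) (p q : 'I_n -> {mpoly R[i][k]}),
    (forall i, p i \is (d i).-homog /\ q i \is (d i).-homog) ->
    let U := [set v | X v /\ forall i, evalp (q i) v != 0] in
    exists2 g, regular_on U g &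
      forall v tau, U v -> tangent_frame X v tau ->
        g v = s v tau *
              (\det (\matrix_(i, j) diff_frac (p i) (q i) v (row j tau))) ^+ m.

(* Some global sections s_1, ..., s_r of (-K_X)^m without common zeros define a
   closed embedding [s_1 : ... : s_r], i.e. (-K_X)^m is the pullback of O(1)
   under some closed embedding into a projective space. *)
Definition anticanonical_very_ample (R : realType) k (X : set 'rV[R[i]]_k) n
    (m : nat) :=
  exists r (s : 'I_r -> 'rV[R[i]]_k -> 'M[R[i]]_(n, k) -> R[i]) phi,
    [/\ forall i, anticanonical_section X m (s i), closed_embedding X phi &
      forall v tau, X v -> tangent_frame X v tau ->
        proj_eq (\row_i s i v tau) (phi v)].

Definition anticanonical_ample (R : realType) k (X : set 'rV[R[i]]_k) n :=
  exists2 m, (0 < m)%N & anticanonical_very_ample X n m.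

Definition fano (R : realType) k (X : set 'rV[R[i]]_k) :=
  exists2 n, smooth_variety X n & anticanonical_ample X n.

(* P(L) is a linear space of dimension d contained in X. *)
Definition linear_space_in (R : realType) k (X : set 'rV[R[i]]_k) (d : nat)
    (L : {vspace 'rV[R[i]]_k}) :=
  (\dim L = d.+1)%N /\ forall w, w \in L -> w != 0 -> X w.

Definition covered_by_linear (R : realType) k (d : nat)
    (X : set 'rV[R[i]]_k) :=
  generally X (fun v => exists2 L, linear_space_in X d L & v \in L).

Definition covered_by_lines (R : realType) k (X : set 'rV[R[i]]_k) :=
  covered_by_linear 1 X.

(* The tangent directions at [v] of the lines on X through [v], as a subset of
   P(T_[v]X), which is identified with P(C^n) by means of the frame tau. *)
Definition line_directions (R : realType) k (X : set 'rV[R[i]]_k)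
    (v : 'rV[R[i]]_k) n (tau : 'M[R[i]]_(n, k)) : set 'rV[R[i]]_n :=
  [set u | u != 0 /\
    exists L, [/\ linear_space_in X 1 L, v \in L & u *m tau \in L]].

(* H is a family of lines on X through [v], in some linear coordinates on
   P(T_[v]X).  Lines through [v] correspond bijectively to their tangent
   directions, so the components of F_1(X,[v]) are those of the closed set of
   tangent directions. *)
Definition line_family (R : realType) k (X : set 'rV[R[i]]_k)
    (v : 'rV[R[i]]_k) n (H : set 'rV[R[i]]_n) :=
  exists2 tau : 'M[R[i]]_(n, k), tangent_frame X v tau &
    pcomponent H (line_directions X v tau).

(* There is a chain X |= H_1 |= ... |= H_m, i.e. an m-th order family of lines
   (for m = 0, the empty chain). *)
Fixpoint has_family_of_order (R : realType) (m : nat) k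
    (X : set 'rV[R[i]]_k) : Prop :=
  if m isn't m'.+1 then True else
  [/\ fano X, covered_by_lines X & generally X (fun v =>
      exists n (H : set 'rV[R[i]]_n),
        line_family X v H /\ has_family_of_order m' H)].

Definition is_S (R : realType) k (X : set 'rV[R[i]]_k) (m : nat) :=
  has_family_of_order m X /\
  forall m', has_family_of_order m' X -> (m' <= m)%N.

(* The invariant S_X; see S_invP below for the existence of the maximum. *)
Definition S_inv (R : realType) k (X : set 'rV[R[i]]_k) : nat :=
  xget 0%N (is_S X).

Lemma has_family_of_order_bound (R : realType) m k (X : set 'rV[R[i]]_k) :
  has_family_of_order m X -> (m <= k)%N.
Proof.
elim: m k X => [//|m IHm] k X /= [_ _ [A [_ XA gen]]].
have [v [Xv Av]] : exists v, X v /\ ~ A v.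
  by apply: contra_notP XA => nex v Xv; apply: contrapT => Av; apply: nex; exists v.
have [n [H [[tau [free_tau _] _] /IHm m_le_n]]] := gen v Xv Av.
apply: leq_trans (_ : n.+1 <= k)%N; first by [].
by have := rank_leq_col (col_mx v tau); rewrite (eqP free_tau).
Qed.

Lemma S_invP (R : realType) k (X : set 'rV[R[i]]_k) : is_S X (S_inv X).
Proof.
suff [m mS] : exists m, is_S X m by exact: xgetI mS.
pose P m := `[< has_family_of_order m X >].
have exP : exists m, P m by exists 0%N; apply/asboolP.
have ubP m : P m -> (m <= k)%N by move/asboolP; exact: has_family_of_order_bound.
case: (ex_maxnP exP ubP) => m /asboolP Pm max_m.
by exists m; split=> // m' Pm'; apply: max_m; apply/asboolP.
Qed.

(* Main.v *)
Require Import Defs.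
From mathcomp Require Import all_boot all_order all_algebra.
From mathcomp Require Import classical_sets reals complex.
From mathcomp Require Import boolp mpoly.

(** A chain X |= H_1 |= ... |= H_m forces a linear space of dimension m in X
    through a general point.  The reason is that a family of lines H through
    [v] consists of tangent directions at [v]: if P(L) is a linear space of
    dimension d contained in H, then the lines of X through [v] whose
    directions lie in P(L) sweep out a cone with vertex [v] over P(L), and this
    cone is a linear space of dimension d + 1 contained in X
    ([linear_space_in_cone]).  Starting from the points of H_m and coning
    successively over H_m, ..., H_1 one gets the result by induction on m
    ([covered_by_linear_of_family]).

    The cone passes through [v] whatever the position of P(L) in H, so the
    general choice of [v] alone makes these linear spaces cover X. *)

Set Implicit Arguments.
Unset Strict Implicit.
Import GRing.Theory.
Local Open Scope ring_scope.
Local Open Scope classical_set_scope.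
Local Open Scope complex_scope.

Lemma pclosed_set0 (R : realType) k : pclosed (set0 : set 'rV[R[i]]_k).
Proof.
exists [set 1] => [f ->|]; first by exists 0%N; exact: dhomog1.
rewrite predeqE => v; split=> // -[_ /(_ 1 erefl)].
by rewrite /evalp rmorph1 => /eqP; rewrite oner_eq0.
Qed.

Lemma pclosed_neq0 (R : realType) k (Z : set 'rV[R[i]]_k) v :
  pclosed Z -> Z v -> v != 0.
Proof. by move=> [F _ ->] []. Qed.

Lemma pclosed_scale (R : realType) k (Z : set 'rV[R[i]]_k) (c : R[i]) v :
  pclosed Z -> Z v -> c != 0 -> Z (c *: v).
Proof.
move=> [F homF ->] [v0 Fv] c0; split; first by rewrite scaler_eq0 negb_or c0.
move=> f Ff; have [d fd] := homF f Ff.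
suff -> : evalp f (c *: v) = c ^+ d * evalp f v by rewrite Fv ?mulr0.
rewrite /evalp !mevalE mulr_sumr; apply: eq_big_seq => t tf.
rewrite (eq_bigr (fun i => c ^+ t i * v 0 i ^+ t i)) => [|i _]; last first.
  by rewrite mxE exprMn.
rewrite big_split /= prodrXr -mdegE (dhomogP _ _ _ fd t tf).
by rewrite mulrCA.
Qed.

Lemma generally_nonempty (R : realType) k (X P : set 'rV[R[i]]_k) :
  generally X P -> exists2 v, X v & P v.
Proof.
move=> [A [_ XA gen]]; apply: contra_notP XA => nex v Xv.
by apply: contrapT => Av; apply: nex; exists v => //; exact: gen.
Qed.

(** The case of order zero: the points of X are its linear spaces of dimension
    zero, as the punctured cone X is stable under scaling. *)
Lemma irreducible_covered_by_points (R : realType) k (X : set 'rV[R[i]]_k) :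
  pirreducible X -> covered_by_linear 0 X.
Proof.
move=> [[v Xv] clX _]; exists set0; split; first exact: pclosed_set0.
  by move/(_ v Xv).
move=> w Xw _; have w0 := pclosed_neq0 clX Xw.
exists <[w]>%VS; last exact: memv_line.
split; first by rewrite dim_vline w0.
move=> _ /vlineP[c ->]; rewrite scaler_eq0 negb_or => /andP[c0 _].
exact: pclosed_scale.
Qed.

(** A vector in the span of [v] and L *m tau is a combination of [v] and some
    u *m tau with u in L; both lie in the line of X through [v] with direction
    u, which is why the whole span lies in X.  Independence of [v] and the rows
    of tau makes the dimension grow by exactly one. *)
Lemma linear_space_in_cone (R : realType) k (X : set 'rV[R[i]]_k) v n
    (tau : 'M[R[i]]_(n, k)) d (L : {vspace 'rV[R[i]]_n}) :
  pclosed X -> X v -> row_free (col_mx v tau) ->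
  linear_space_in (line_directions X v tau) d L ->
  exists2 L', linear_space_in X d.+1 L' & v \in L'.
Proof.
move=> clX Xv free_tau [dimL subL].
have v0 := pclosed_neq0 clX Xv.
pose f : 'Hom('rV[R[i]]_n, 'rV[R[i]]_k) := linfun (mulmxr tau).
have fE u : f u = u *m tau by rewrite lfunE.
have indep (a : R[i]) (u : 'rV[R[i]]_n) : a *: v + u *m tau = 0 -> u = 0.
  move=> eq0; suff: row_mx a%:M u = 0.
    by rewrite -row_mx0 => /eq_row_mx[].
  by apply: (row_free_inj free_tau); rewrite mul_row_col mul_scalar_mx eq0 mul0mx.
exists (<[v]> + f @: L)%VS; last exact: (subvP (addvSl _ _)) (memv_line v).
split=> [|w].
  rewrite dimv_disjoint_sum ?dim_vline ?v0 ?limg_dim_eq ?dimL //.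
    apply/eqP; rewrite -subv0; apply/subvP=> u /memv_capP[_].
    rewrite memv_ker fE memv0 => /eqP ut0.
    by apply/eqP/(indep 0); rewrite scale0r add0r.
  apply/eqP; rewrite -subv0; apply/subvP=> w /memv_capP[/vlineP[a ->]].
  move=> /memv_imgP[u _]; rewrite fE memv0 => av.
  have u0 : u = 0 by apply: (indep (- a)); rewrite scaleNr av addNr.
  by rewrite av u0 mul0mx.
move=> /memv_addP[_ /vlineP[a ->] [_ /memv_imgP[u Lu ->] ->]]; rewrite fE.
have [->|u0] := eqVneq u 0.
  rewrite mul0mx addr0 scaler_eq0 negb_or => /andP[a0 _].
  exact: pclosed_scale.
have [_ [l [[_ lX] lv lu]]] := subL u Lu u0.
by apply: lX; rewrite memvD ?memvZ.
Qed.

Lemma covered_by_linear_of_family (R : realType) m k (X : set 'rV[R[i]]_k) :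
  pirreducible X -> has_family_of_order m X -> covered_by_linear m X.
Proof.
elim: m k X => [|m IHm] k X irrX.
  by move=> _; exact: irreducible_covered_by_points.
move=> /= [_ _ [A [clA XA gen]]]; exists A; split=> // v Xv Av.
have [n [H [[tau [free_tau _] [irrH subH _]] famH]]] := gen v Xv Av.
have [_ _ [L [dimL LH] _]] := generally_nonempty (IHm _ _ irrH famH).
have [_ clX _] := irrX.
apply: (linear_space_in_cone clX Xv free_tau (L := L)).
by split=> // u Lu u0; apply/subH/LH.
Qed.

Theorem proposition3p3 (R : realType) (N : nat)
    (X : set 'rV[complex R]_N.+1) (hX : fano X) :
  exists2 d : nat, (S_inv X <= d)%N & covered_by_linear d X.
Proof.
exists (S_inv X) => //; have [n [irrX _ _] _] := hX.
by apply: covered_by_linear_of_family => //; have [] := S_invP X.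
Qed.
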